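(* Let $r,s \geq 2$ be integers. For every prime $p$, \[ (-1)^r \, \Psi_{r,s}(p) \equiv (-1)^s \, \Psi_{s,r}(p) \pmod{p}. \] Moreover, \[ \mathcal{B}_{r,s} + \sum_{p} \frac{1}{p} \, \Psi_{r,s}(p) \in \mathbb{Z} \] (sum over all primes, only finitely many terms being nonzero), and \[ \mathcal{D}_{r,s} = \prod_{p \text{ prime},\ p \,\nmid\, \Psi_{r,s}(p)} p, \] where in both the sum and the product the primes $p$ may be restricted to $3 \leq p \leq r+s+1$. Furthermore: (i) $2 \mid \Psi_{r,s}(2)$; (ii) $3 \nmid \Psi_{r,s}(3)$; (iii) $p \nmid \Psi_{r,s}(p)$ for every prime $p \geq 5$ such that $p-1 \mid r$ or $p-1 \mid s$.
   Context: The Bernoulli numbers $\mathbf{B}_n$ are defined by $\frac{t}{e^t-1} = \sum_{n \geq 0} \mathbf{B}_n \frac{t^n}{n!}$ (so $\mathbf{B}_1 = -\tfrac12$). For integers $r,s \geq 0$ define $\mathcal{B}_{r,s} = \sum_{\nu=0}^{r} \binom{r}{\nu} \mathbf{B}_{s+\nu}$, and $\mathcal{D}_{r,s}$ = the smallest positive integer $d$ with $d\,\mathcal{B}_{r,s} \in \mathbb{Z}$. For integers $r,s \geq 0$ and a prime $p$, define \[ \Psi_{r,s}(p) = \sum_{\substack{0 \leq \nu \leq r\\ 2 \,\mid\, s+\nu\\ p-1 \,\mid\, s+\nu}} \binom{r}{\nu}. \] *)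

(* Defs.v *)
From mathcomp Require Import all_boot all_order all_algebra.
From mathcomp Require Import boolp classical_sets cardinality fsbigop.

Set Implicit Arguments.
Unset Strict Implicit.
Unset Printing Implicit Defensive.

Import Order.TTheory GRing.Theory Num.Theory.
Local Open Scope ring_scope.

(* Formal power series over the rationals are coefficient sequences nat -> rat. *)
Definition fps_mul (a b : nat -> rat) (n : nat) : rat :=
  \sum_(i < n.+1) a i * b (n - i)%N.

(* The first n coefficients of 1 / a(t), from solving a * b = 1 degree by
   degree; meaningful when a 0 != 0 (see fps_mulV). *)
Fixpoint fps_inv_seq (a : nat -> rat) (n : nat) : seq rat :=
  if n is m.+1 then
    let b := fps_inv_seq a m in
    rcons b ((a 0%N)^-1 * ((m == 0%N)%:R - \sum_(i < m) a (m - i)%N * b`_i))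
  else [::].

Definition fps_inv (a : nat -> rat) (n : nat) : rat := (fps_inv_seq a n.+1)`_n.

Lemma size_fps_inv_seq a n : size (fps_inv_seq a n) = n.
Proof. by elim: n => //= n IHn; rewrite size_rcons IHn. Qed.

Lemma nth_fps_inv_seq a n i : (i < n)%N -> (fps_inv_seq a n)`_i = fps_inv a i.
Proof.
elim: n => // n IHn; rewrite ltnS leq_eqVlt => /orP[/eqP-> //|lt_in].
by rewrite /= nth_rcons size_fps_inv_seq lt_in IHn.
Qed.

Lemma fps_invE a n : fps_inv a n =
  (a 0%N)^-1 * ((n == 0%N)%:R - \sum_(i < n) a (n - i)%N * fps_inv a i).
Proof.
rewrite {1}/fps_inv /= nth_rcons size_fps_inv_seq ltnn eqxx.
by congr (_ * (_ - _)); apply: eq_bigr => i _; rewrite nth_fps_inv_seq.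
Qed.

Lemma fps_mulV a n : a 0%N != 0 -> fps_mul a (fps_inv a) n = (n == 0%N)%:R.
Proof.
move=> a0; rewrite /fps_mul (reindex_inj rev_ord_inj) /=.
rewrite big_ord_recr /= !subSS !subnn subn0 [fps_inv a n]fps_invE mulVKf //.
rewrite (eq_bigr (fun i : 'I_n => a (n - i)%N * fps_inv a i)); last first.
  by move=> i _; rewrite subSS subKn // ltnW.
by rewrite addrC subrK.
Qed.

(* e^t - 1 *)
Definition exp_sub1 (n : nat) : rat := if n is 0%N then 0 else (n`!)%:R^-1.

(* B_n = n! [t^n] t / (e^t - 1), where t / (e^t - 1) is the inverse of the
   series (e^t - 1) / t. *)
Definition bernoulli (n : nat) : rat :=
  (n`!)%:R * fps_inv (fun k => exp_sub1 k.+1) n.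

Lemma bernoulli_gen n :
  fps_mul exp_sub1 (fun k => bernoulli k / (k`!)%:R) n = (n == 1%N)%:R.
Proof.
rewrite /fps_mul big_ord_recl mul0r add0r.
case: n => [|n]; first by rewrite big_ord0.
rewrite eqSS -(@fps_mulV (fun k => exp_sub1 k.+1)) //.
apply: eq_bigr => i _; congr (_ * _).
by rewrite /bernoulli mulrC mulKf // pnatr_eq0 -lt0n fact_gt0.
Qed.

Definition calB (r s : nat) : rat :=
  \sum_(0 <= nu < r.+1) 'C(r, nu)%:R * bernoulli (s + nu)%N.

Lemma calD_exists (r s : nat) :
  exists d : nat, (0 < d)%N && (d%:R * calB r s \is a Num.int).
Proof.
exists `|denq (calB r s)|%N; rewrite absz_gt0 denq_neq0 /=.
have -> : `|denq (calB r s)|%:R = (denq (calB r s))%:~R :> rat.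
  by rewrite -[RHS]/(_%:~R) -{2}[denq _]gez0_abs ?denq_ge0.
by rewrite mulrC -numqE intr_int.
Qed.

Definition calD (r s : nat) : nat := ex_minn (calD_exists r s).

Definition Psi (r s p : nat) : nat :=
  (\sum_(0 <= nu < r.+1 | (2 %| s + nu) && (p.-1 %| s + nu)) 'C(r, nu))%N.

(* Main.v *)
(* With [D_k f = \sum_j (-1)^j C(k, j) f j], one has
   [B_n = \sum_(k < N) D_k (x^n) / (k + 1)] for every [N > n].  As [k!] divides
   [D_k (x^n)], only the terms with [k + 1] prime or equal to [4] can fail to be
   integers.  For a prime [k + 1 = p], [D_k (x^n)] is modulo [p] the power sum
   [\sum_(x : F_p) x^n], that is [-1] or [0] according to whether [p - 1] divides
   [n]; the terms [k = 1] and [k = 3] are combined modulo [4].  This yields von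
   Staudt-Clausen for even [n] and the integrality of [B_n] for odd [n > 1], and
   summing over [nu] gives the statements on [calB] and [calD].

   For odd [p], expanding [(1 + x)^r] gives
   [- Psi r s p = \sum_(x : F_p) x^s (1 + x)^r] modulo [p], and the substitution
   [x -> -1 - x] exchanges [r] and [s].  If [p - 1] divides [s], the sum is
   [\sum_(y != 1) y^r], which is [-1] or [-2]. *)

Require Import Defs.
From mathcomp Require Import all_boot all_order all_algebra all_field.
From mathcomp Require Import ring zify.
From mathcomp Require Import boolp classical_sets cardinality fsbigop.

Import Order.TTheory GRing.Theory Num.Theory.
Local Open Scope classical_set_scope.
Local Open Scope ring_scope.

(** * Alternating binomial sums and powers *)

(* [(-1) ^+ k] times the [k]-th forward difference of [f] at [0]. *)
Definition altsum (R : comNzRingType) (k : nat) (f : nat -> R) : R :=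
  \sum_(j < k.+1) (-1) ^+ j * f j *+ 'C(k, j).

Lemma eq_altsum (R : comNzRingType) (k : nat) (f g : nat -> R) :
  f =1 g -> altsum R k f = altsum R k g.
Proof. by move=> fg; apply: eq_bigr => j _; rewrite fg. Qed.

Lemma altsum0 (R : comNzRingType) (f : nat -> R) : altsum R 0 f = f 0%N.
Proof. by rewrite /altsum big_ord1 expr0 mul1r. Qed.

Lemma altsumS (R : comNzRingType) (k : nat) (f : nat -> R) :
  altsum R k.+1 f = altsum R k f - altsum R k (fun j => f j.+1).
Proof.
rewrite /altsum big_ord_recl (eq_bigr (fun j : 'I_k.+1 =>
  (-1) ^+ j.+1 * f j.+1 *+ 'C(k, j.+1) - (-1) ^+ j * f j.+1 *+ 'C(k, j))).
  rewrite big_split /= sumrN addrA; congr (_ - _).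
  rewrite [in RHS]big_ord_recl big_ord_recr /= !bin0 bin_small // mulr0n addr0.
  by congr (_ + _); apply: eq_bigr.
by move=> j _; rewrite binS mulrnDr exprS !mulN1r !mulNr !mulNrn.
Qed.

(** The term [j = 0] vanishes, and the absorption identity [(j+1) C(k+1, j+1) = (k+1) C(k, j)]
    handles the others. *)
Lemma altsum_absorb (R : comNzRingType) (k : nat) (g : nat -> R) :
  altsum R k.+1 (fun j => j%:R * g j)
  = - (k.+1%:R * altsum R k (fun j => g j.+1)).
Proof.
rewrite /altsum big_ord_recl /= mul0r mulr0 mul0rn add0r mulr_sumr -sumrN.
apply: eq_bigr => j _; rewrite exprS.
have := congr1 (fun m => m%:R : R) (mul_bin_diag k.+1 j); rewrite !natrM => E.
rewrite -[LHS]mulr_natr -[X in - (_ * X)]mulr_natr.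
rewrite [X in 'C(_, X)]/= /bump /= add1n.
have -> : -1 * (-1) ^+ j * (j.+1%:R * g j.+1) * 'C(k.+1, j.+1)%:R
   = - ((-1) ^+ j * g j.+1 * (j.+1%:R * 'C(k.+1, j.+1)%:R)) by ring.
rewrite -E; ring.
Qed.

Lemma altsum_sum (R : comNzRingType) (I : Type) (r : seq I) (k : nat)
    (c : I -> R) (f : I -> nat -> R) :
  altsum R k (fun j => \sum_(i <- r) c i * f i j)
  = \sum_(i <- r) c i * altsum R k (f i).
Proof.
under [RHS]eq_bigr do rewrite mulr_sumr.
rewrite [RHS]exchange_big /=; apply: eq_bigr => j _.
rewrite mulr_sumr -sumrMnl; apply: eq_bigr => i _.
by rewrite mulrnAr mulrCA.
Qed.

(** This is [(-1)^k k! S(n, k)], with [S] the Stirling numbers of the second kind. The ring is a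
    parameter because the same sum is used over [rat], [int] and ['F_p]. *)
Definition altpow (R : comNzRingType) (k n : nat) : R :=
  altsum R k (fun j => j%:R ^+ n).

Lemma altpow_intr (R : comNzRingType) (k n : nat) :
  altpow R k n = (altpow int k n)%:~R.
Proof.
rewrite /altpow /altsum rmorph_sum; apply: eq_bigr => j _ /=.
by rewrite rmorphMn rmorphM !rmorphXn /= rmorphN1 rmorph_nat.
Qed.

Lemma altsum_powS (R : comNzRingType) (k n : nat) :
  altsum R k (fun j => j.+1%:R ^+ n)
  = \sum_(i < n.+1) 'C(n, i)%:R * altpow R k i.
Proof.
rewrite -altsum_sum; apply: eq_altsum => j.
rewrite -addn1 natrD addrC exprDn; apply: eq_bigr => i _.
by rewrite expr1n mul1r mulr_natl.
Qed.

(** Absorbing one factor [j] of [j^(n+1)] lowers both indices. The explicit factor [k+1] later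
    builds up [k!]. *)
Lemma altpowSS (R : comNzRingType) (k n : nat) :
  altpow R k.+1 n.+1 = - (k.+1%:R * \sum_(i < n.+1) 'C(n, i)%:R * altpow R k i).
Proof.
rewrite -altsum_powS -(altsum_absorb R k (fun j => j%:R ^+ n)); apply: eq_altsum => j.
by rewrite exprS.
Qed.

Lemma altpowS0 (R : comNzRingType) (k : nat) : altpow R k.+1 0 = 0.
Proof. by rewrite /altpow altsumS; apply: subrr. Qed.

Lemma altpow_small (R : comNzRingType) (k n : nat) : (n < k)%N -> altpow R k n = 0.
Proof.
elim: k n => // k IHk [_|n]; first exact: altpowS0.
rewrite ltnS => lt_nk; rewrite altpowSS big1 ?mulr0 ?oppr0 // => i _.
by rewrite IHk ?mulr0 // (leq_trans (ltn_ord i)).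
Qed.

Lemma dvdz_fact_altpow (k n : nat) : ((k`!)%:Z %| altpow int k n)%Z.
Proof.
elim: k n => [|k IHk] [|n]; rewrite ?fact0 ?dvd1z ?altpowS0 ?dvdz0 //.
rewrite altpowSS factS PoszM rpredN dvdz_mul ?intz ?dvdzz ?natz //.
by apply: rpred_sum => i _; apply: dvdz_mull.
Qed.

(** * Bernoulli numbers as sums of differences of powers *)

(** This is [n!] times the coefficient of [t^n] in [(e^t - 1) * (t / (e^t - 1)) = t]. *)
Lemma bernoulli_rec (n : nat) :
  \sum_(i < n) 'C(n, i)%:R * bernoulli i = (n == 1%N)%:R.
Proof.
have := bernoulli_gen n; rewrite /fps_mul (reindex_inj rev_ord_inj) /=.
rewrite big_ord_recr /= subSS subnn /= mul0r addr0 => E.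
transitivity ((n`!)%:R * (n == 1%N)%:R : rat); last first.
  by case: eqP => [->|_]; rewrite ?mulr0 ?mulr1.
rewrite -E mulr_sumr; apply: eq_bigr => i _.
rewrite subSS subKn 1?ltnW // /exp_sub1.
case Ei: (n - i)%N => [|m]; first by move: (ltn_ord i); rewrite -subn_gt0 Ei.
rewrite -Ei -(bin_fact (ltnW (ltn_ord i))) !natrM.
have fi m' : (m'`!)%:R != 0 :> rat by rewrite pnatr_eq0 -lt0n fact_gt0.
by field; rewrite !fi.
Qed.

(** In the instance [n+1] of the recurrence, [b n] has the nonzero coefficient [n+1], so it is
    determined by the earlier values. *)
Lemma bernoulli_unique (b : nat -> rat) :
  (forall n, \sum_(i < n) 'C(n, i)%:R * b i = (n == 1%N)%:R) ->
  forall n, b n = bernoulli n.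
Proof.
move=> rec_b; elim/ltn_ind => n IHn.
have := rec_b n.+1; rewrite -bernoulli_rec !big_ord_recr /=.
rewrite (eq_bigr (fun i : 'I_n => 'C(n.+1, i)%:R * bernoulli i)) => [/addrI|i _].
  by apply: mulfI; rewrite pnatr_eq0 binSn.
by rewrite IHn.
Qed.

(* By [altsum_absorb] the recurrence for the right-hand side telescopes; this
   is [d/dx = log (1 + Delta)] applied to [x ^+ n] at [0]. *)
Lemma bernoulli_altpow (n N : nat) : (n < N)%N ->
  bernoulli n = \sum_(k < N) altpow rat k n / k.+1%:R.
Proof.
(* Terms with [k > m] vanish, so the truncation bound is immaterial; all [i <= n] can then share the
   bound [n+1], which allows exchanging the sums. *)
have stab m M M' : (m < M)%N -> (M <= M')%N ->
    \sum_(k < M') altpow rat k m / k.+1%:R = \sum_(k < M) altpow rat k m / k.+1%:R.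
  move=> lt_mM /subnKC<-; elim: (_ - _)%N => [|e IHe]; first by rewrite addn0.
  by rewrite addnS big_ord_recr /= IHe altpow_small ?mul0r ?addr0 //; lia.
move=> lt_nN; rewrite (stab n n.+1 N) //.
rewrite -[LHS](bernoulli_unique (fun n => \sum_(k < n.+1) altpow rat k n / k.+1%:R)) //.
move=> {n N lt_nN} [|n]; first by rewrite big_ord0.
rewrite (eq_bigr (fun i : 'I_n.+1 =>
    \sum_(k < n.+1) 'C(n.+1, i)%:R * altpow rat k i / k.+1%:R)); last first.
  move=> i _; rewrite -(stab i i.+1 n.+1) // mulr_sumr.
  by apply: eq_bigr => k _; rewrite mulrA.
rewrite exchange_big /=.
(* The inner sum is the expansion of [(j+1)^(n+1)] without its top term, hence
   [- altpow (k+1) (n+1)]. By [altpowSS] this is [k+1] times a difference of consecutive [g]. *)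
pose g k := altpow rat k n.
rewrite (eq_bigr (fun k : 'I_n.+1 => g k - g k.+1)); last first.
  move=> k _; rewrite -mulr_suml.
  have -> : \sum_(i < n.+1) 'C(n.+1, i)%:R * altpow rat k i = - altpow rat k.+1 n.+1.
    rewrite [altpow _ k.+1 _]altsumS altsum_powS [in RHS]big_ord_recr /= binn mul1r.
    by rewrite opprB addrK.
  rewrite altpowSS opprK mulrC mulKf ?pnatr_eq0 // -altsum_powS /g.
  by rewrite [altpow _ k.+1 _]altsumS opprB addrC subrK.
rewrite -(big_mkord xpredT (fun k => g k - g k.+1)).
rewrite (telescope_sumr_eq (fun k => - g k)) //; last first.
  by move=> k _; rewrite opprK addrC.
(* At the ends of the telescope, [g (n+1) = 0] and [g 0 = 0^n], which is 1 exactly when [n = 0]. *)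
rewrite opprK /g altpow_small // oppr0 add0r /altpow altsum0 expr0n.
by rewrite eqSS.
Qed.

(** * Composite divisors of factorials *)

(** Write [m = q p] with [p] the least prime factor. If [p < q], both are distinct factors of
    [(m-1)!]. If [p = q > 2], then [p] and [2p] are distinct factors below [p^2]; only [m = 4]
    escapes. *)
Lemma dvdn_fact_composite (m : nat) :
  (1 < m)%N -> ~~ prime m -> m != 4%N -> (m %| (m.-1)`!)%N.
Proof.
move=> m_gt1 m_nprime m_neq4.
have p_prime := pdiv_prime m_gt1; set p := pdiv m in p_prime *.
have p_gt1 := prime_gt1 p_prime.
have [q def_m] := dvdnP (pdiv_dvd m); rewrite -/p in def_m.
have q_gt1 : (1 < q)%N.
  have q_neq1 : q != 1%N by apply: contraNneq m_nprime => q1; rewrite def_m q1 mul1n.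
  by case: q def_m q_neq1 m_gt1 => [|[|q]] // ->.
have le_pq : (p <= q)%N by apply: pdiv_min_dvd => //; rewrite def_m dvdn_mulr.
clearbody p.
have fact_mono a b : (a <= b)%N -> (a`! %| b`!)%N.
  by move=> /subnKC<-; elim: (b - a)%N => [|e IHe]; rewrite ?addn0 ?addnS ?factS ?dvdn_mull.
have pred_dvd a b : (0 < b)%N -> (a < b)%N -> (0 < a)%N -> (b * a %| b`!)%N.
  move=> b_gt0 lt_ab a_gt0; rewrite -{2}(prednK b_gt0) factS prednK //.
  apply: dvdn_mul => //; apply: dvdn_trans (fact_mono a b.-1 _); last lia.
  by rewrite dvdn_fact // a_gt0 leqnn.
move: le_pq; rewrite leq_eqVlt => /orP[/eqP eq_pq|lt_pq].
  have p_gt2 : (2 < p)%N.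
    rewrite ltn_neqAle p_gt1 andbT; apply: contraNneq m_neq4 => p2.
    by rewrite def_m -eq_pq -p2.
  apply: dvdn_trans (fact_mono (p * 2)%N m.-1 _); last by rewrite def_m -eq_pq; nia.
  apply: dvdn_trans (pred_dvd p (p * 2)%N _ _ _); try lia.
  by rewrite def_m -eq_pq dvdn_mul ?dvdn_mulr.
apply: dvdn_trans (fact_mono q m.-1 _); last by rewrite def_m; nia.
by rewrite def_m; apply: pred_dvd => //; lia.
Qed.

(** * Power sums over finite fields *)

Lemma sum_finField_exp (F : finFieldType) (n : nat) : (0 < n)%N ->
  \sum_(x : F) x ^+ n = if (#|F|.-1 %| n)%N then -1 else 0.
Proof.
move=> n_gt0; set q := #|F|.-1.
have q_gt0 : (0 < q)%N by rewrite -ltnS prednK ?finNzRing_gt1 // ltnW ?finNzRing_gt1.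
have def_q : #|F| = q.+1 by rewrite prednK // ltnW ?finNzRing_gt1.
have expq (x : F) : x != 0 -> x ^+ q = 1.
  by move=> x0; apply: (mulfI x0); rewrite mulr1 -exprS -def_q expf_card.
case: ifPn => [q_dvd|n_ndvd].
  (* Translation by 1 permutes [F], so adding [#|F|] to the sum of all elements does not change
     it. *)
  have card0 : #|F|%:R = 0 :> F.
    apply: (@addrI _ (\sum_(x : F) x)); rewrite addr0 -sum1_card natr_sum -big_split /=.
    by rewrite [RHS](reindex_inj (addIr 1)).
  rewrite (eq_bigr (fun x : F => (x != 0)%:R)) => [|x _].
    rewrite (bigD1 0) //= eqxx add0r (eq_bigr (fun=> 1)) => [|x ->] //.
    by rewrite sumr_const cardC1 -/q -[in RHS](addrK 1 (-1)) addNr -card0 def_q mulrSr addrK.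
  have [->|x_neq0] := eqVneq x 0; first by rewrite expr0n gtn_eqF.
  by have /dvdnP[m ->] := q_dvd; rewrite mulnC exprM expq // expr1n.
have [a a_neq0 an_neq1] : exists2 a : F, a != 0 & a ^+ n != 1.
  case: (pickP (fun a : F => (a != 0) && (a ^+ n != 1))) => [a /andP[]|an1].
    by exists a.
  (* Otherwise all [q] nonzero elements would be roots of [X^(n mod q) - 1], whose positive degree
     is less than [q]. *)
  have: (size (enum (predC1 (0%R : F))) <= n %% q)%N.
    apply: max_unity_roots; rewrite ?enum_uniq ?lt0n //.
    apply/allP => x; rewrite mem_enum !inE => x0.
    have := an1 x; rewrite x0 => /negbFE/eqP; rewrite {1}(divn_eq n q) exprD mulnC.
    by rewrite exprM expq // expr1n mul1r => xn1; apply/unity_rootP.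
  by rewrite -cardE cardC1 leqNgt ltn_mod q_gt0.
(* The substitution [x -> a x] multiplies the power sum by [a^n != 1], so the sum is zero. *)
have: a ^+ n * (\sum_(x : F) x ^+ n) = \sum_(x : F) x ^+ n.
  rewrite [RHS](reindex_inj (mulfI a_neq0)) mulr_sumr.
  by apply: eq_bigr => x _; rewrite exprMn.
move/eqP; rewrite -subr_eq0 -[X in _ - X]mul1r -mulrBl mulf_eq0 subr_eq0.
by rewrite (negPf an_neq1) => /eqP.
Qed.

Lemma dvdn_Fp (p : nat) (p_prime : prime p) (n : nat) : (p %| n)%N = (n%:R == 0 :> 'F_p).
Proof. exact: dvdn_pcharf (pchar_Fp p_prime) n. Qed.

Lemma dvdz_Fp (p : nat) (p_prime : prime p) (z : int) : (p %| z)%Z = (z%:~R == 0 :> 'F_p).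
Proof.
rewrite dvdzE absz_nat (dvdn_Fp p p_prime); case: z => n //.
by rewrite NegzE abszN mulrNz oppr_eq0.
Qed.

Lemma sum_Fp_nat (p : nat) (p_prime : prime p) (R : nmodType) (f : 'F_p -> R) :
  \sum_(x : 'F_p) f x = \sum_(j < p) f j%:R.
Proof.
pose h j := f j%:R; transitivity (\sum_(x < (Zp_trunc (pdiv p)).+2) h x).
  by apply: eq_bigr => i _; rewrite /h natr_Zp.
by rewrite -(big_mkord xpredT h) Fp_cast // big_mkord.
Qed.

(** By Pascal's rule, consecutive entries of row [p-1] add up to [C(p, j+1)], which is zero modulo
    [p]; hence the signs alternate. *)
Lemma bin_pred_Fp (p : nat) (p_prime : prime p) (j : nat) : (j < p)%N -> 'C(p.-1, j)%:R = (-1) ^+ j :> 'F_p.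
Proof.
elim: j => [|j IHj] lt_jp; first by rewrite bin0.
have p_gt0 := prime_gt0 p_prime.
have: ('C(p, j.+1)%:R = 0 :> 'F_p).
  by apply/eqP; rewrite -(dvdn_Fp p p_prime) prime_dvd_bin //; lia.
rewrite -[X in 'C(X, _)](prednK p_gt0) binS natrD IHj ?(ltnW lt_jp) //.
by move/eqP; rewrite addr_eq0 exprS mulN1r => /eqP.
Qed.

(** Modulo [p] the sign [(-1)^j] cancels against [C(p-1, j)], leaving the plain power sum over
    ['F_p]. *)
Lemma altpow_Fp (p : nat) (p_prime : prime p) (n : nat) : (0 < n)%N ->
  altpow 'F_p p.-1 n = - ((p.-1 %| n)%N)%:R.
Proof.
move=> n_gt0; transitivity (\sum_(x : 'F_p) x ^+ n).
  rewrite (sum_Fp_nat p p_prime) /altpow /altsum prednK ?prime_gt0 //.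
  apply: eq_bigr => j _; rewrite -mulr_natr bin_pred_Fp // mulrAC -expr2.
  by rewrite -exprM mulnC exprM sqrrN !expr1n mul1r.
by rewrite sum_finField_exp // card_Fp //; case: ifP => _; rewrite ?oppr0.
Qed.

(** * [Psi] modulo primes *)

Lemma Psi_Fp (p : nat) (p_prime : prime p) (r s : nat) : (2 < p)%N -> (0 < s)%N ->
  (Psi r s p)%:R = - \sum_(x : 'F_p) x ^+ s * (1 + x) ^+ r.
Proof.
move=> p_gt2 s_gt0.
under eq_bigr do rewrite exprDn mulr_sumr.
rewrite exchange_big /= -sumrN /Psi big_mkcond big_mkord natr_sum.
apply: eq_bigr => nu _.
(* For odd [p], [p-1] is even, so the parity condition is implied. *)
have -> : (2 %| s + nu)%N && (p.-1 %| s + nu)%N = (p.-1 %| s + nu)%N.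
  apply: andb_idl => /(dvdn_trans _)-> //.
  by have := even_prime p_prime; case: (p) p_gt2 => // m; lia.
rewrite (eq_bigr (fun x : 'F_p => 'C(r, nu)%:R * x ^+ (s + nu))) => [|x _].
  rewrite -mulr_sumr sum_finField_exp ?addn_gt0 ?s_gt0 // card_Fp //.
  by case: ifP => _; rewrite ?mulrN1 ?mulr0 ?opprK ?oppr0.
by rewrite expr1n mul1r mulrnAr -exprD mulr_natl.
Qed.

Lemma Psi_swap_Fp (p r s : nat) : prime p -> (2 < p)%N -> (0 < r)%N -> (0 < s)%N ->
  (Psi r s p)%:R = (-1) ^+ (r + s) * (Psi s r p)%:R :> 'F_p.
Proof.
move=> p_prime p_gt2 r_gt0 s_gt0; rewrite !Psi_Fp // mulrN mulr_sumr.
congr (- _); rewrite (reindex_inj (inj_comp (addrI (-1)) oppr_inj)) /=.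
apply: eq_bigr => x _; rewrite addrA subrr add0r -opprD.
by rewrite (exprNn (1 + x)) (exprNn x) exprD; ring.
Qed.

Lemma sum_shift_Fp_neq0 (p r s : nat) : prime p -> (2 < p)%N ->
  (0 < r)%N -> (0 < s)%N -> (p.-1 %| s)%N ->
  \sum_(x : 'F_p) x ^+ s * (1 + x) ^+ r != 0.
Proof.
move=> p_prime p_gt2 r_gt0 s_gt0 /dvdnP[m def_s].
have xs (x : 'F_p) : x != 0 -> x ^+ s = 1.
  move=> x0; rewrite def_s mulnC exprM.
  have -> : x ^+ p.-1 = 1; last by rewrite expr1n.
  apply: (mulfI x0); rewrite mulr1 -exprS prednK ?prime_gt0 //.
  by rewrite -[in X in x ^+ X](card_Fp p_prime) expf_card.
(* Replacing [x^s] by 1 is wrong only at [x = 0], where it adds the term [(1 + 0)^r = 1]; this is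
   the 1 subtracted. *)
have -> : \sum_(x : 'F_p) x ^+ s * (1 + x) ^+ r = \sum_(x : 'F_p) x ^+ r - 1.
  rewrite [in RHS](reindex_inj (addrI 1)) /= (bigD1 0) //= [in RHS](bigD1 0) //=.
  rewrite expr0n gtn_eqF // mul0r add0r addr0 expr1n addrAC subrr add0r.
  by apply: eq_bigr => x x0; rewrite xs ?mul1r.
rewrite sum_finField_exp // card_Fp //; case: ifP => _; last first.
  by rewrite add0r oppr_eq0 oner_eq0.
(* The value here is [-2], nonzero because [p > 2]. *)
by rewrite -opprD oppr_eq0 -(natrD _ 1 1) -dvdn_Fp // gtnNdvd.
Qed.

Lemma Psi_ndvd (p r s : nat) : prime p -> (2 < p)%N -> (0 < r)%N -> (0 < s)%N ->
  (p.-1 %| r)%N || (p.-1 %| s)%N -> ~~ (p %| Psi r s p)%N.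
Proof.
move=> p_prime p_gt2 r_gt0 s_gt0.
wlog: r s r_gt0 s_gt0 / (p.-1 %| s)%N => [IH /orP[]|p_dvd _].
- move=> dvd_r; rewrite dvdn_Fp // Psi_swap_Fp // mulf_eq0 expf_eq0 oppr_eq0 oner_eq0 andbF /=.
  by rewrite -dvdn_Fp //; apply: IH => //; rewrite dvd_r orbT.
- by move=> dvd_s; apply: IH => //; rewrite dvd_s orbT.
by rewrite dvdn_Fp // Psi_Fp // oppr_eq0 sum_shift_Fp_neq0.
Qed.

(** Over ['F_3] the factor [x^s] kills the term at 0 and [(1 + x)^r] the term at [-1], so only
    [2^r], from [x = 1], survives. *)
Lemma Psi3_ndvd (r s : nat) : (0 < r)%N -> (0 < s)%N -> ~~ (3 %| Psi r s 3)%N.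
Proof.
move=> r_gt0 s_gt0; rewrite dvdn_Fp // Psi_Fp // oppr_eq0 sum_Fp_nat //.
rewrite !big_ord_recl big_ord0 /= /bump /= expr0n gtn_eqF // mul0r add0r.
have -> : 1 + (1 + 1)%:R = 0 :> 'F_3 by apply/eqP.
rewrite expr1n mul1r addr0.
by rewrite expr0n gtn_eqF // mulr0 addr0 expf_neq0.
Qed.

(** For [p = 2] only the parity of [s + nu] matters, and adding [(1+1)^r] to [(-1)^s (1-1)^r = 0]
    doubles exactly the terms with [s + nu] even. *)
Lemma Psi2_double (r s : nat) : (0 < r)%N -> (2 * Psi r s 2 = 2 ^ r)%N.
Proof.
move=> r_gt0; apply/eqP; rewrite -(eqr_nat int) natrM natrX; apply/eqP.
have -> : 2%:R ^+ r = (1 + 1) ^+ r + (-1) ^+ s * (1 - 1) ^+ r :> int.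
  by rewrite subrr expr0n gtn_eqF // mulr0 addr0.
rewrite !exprDn mulr_sumr -big_split /Psi /= big_mkcond big_mkord natr_sum.
rewrite mulr_sumr; apply: eq_bigr => nu _.
rewrite dvd1n andbT dvdn2 !expr1n !mul1r [in RHS]mulrnAr -exprD -mulrnDl.
by rewrite -[(-1) ^+ (s + nu)]signr_odd; case: odd; rewrite /= ?subrr ?mul0rn // mulr_natl -mulrnA mulnC mulrnA.
Qed.

Lemma Psi2_even (r s : nat) : (1 < r)%N -> (2 %| Psi r s 2)%N.
Proof.
case: r => [|[|r]] // _; rewrite -(@dvdn_pmul2l 2) // Psi2_double // !expnS.
by rewrite mulnA dvdn_mulr.
Qed.

Lemma Psi_large (r s p : nat) : (0 < s)%N -> (r + s < p.-1)%N -> Psi r s p = 0%N.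
Proof.
move=> s_gt0 lt_p; rewrite /Psi big_mkord big_pred0 // => nu.
by rewrite (gtnNdvd _ (_ : s + nu < p.-1)%N) ?andbF //; have := ltn_ord nu; lia.
Qed.

(** * Von Staudt-Clausen and integrality for [calB] *)

Lemma natr_div_int (m d : nat) : (0 < d)%N ->
  (m%:R / d%:R : rat) \is a Num.int = (d %| m)%N.
Proof.
move=> d_gt0; have d0 : d%:R != 0 :> rat by rewrite pnatr_eq0 -lt0n.
apply/idP/idP => [/intrP[z /eqP]|/dvdnP[q ->]]; last by rewrite natrM mulfK ?rpred_nat.
rewrite (can2_eq (divfK d0) (mulfK d0)) !pmulrn -intrM eqr_int => /eqP E.
by have : (d %| Posz m)%Z by rewrite E dvdz_mull.
Qed.

Lemma intr_div_int (z : int) (d : nat) : (d %| z)%Z -> (z%:~R / d%:R : rat) \is a Num.int.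
Proof. by move=> dvd_dz; rewrite pmulrn Qint_dvdz. Qed.

Lemma altpow1 (n : nat) : (0 < n)%N -> altpow int 1 n = -1.
Proof.
move=> n_gt0; rewrite /altpow /altsum !big_ord_recl big_ord0 /=.
by rewrite expr0n gtn_eqF // mulr0 mul0rn add0r addr0 expr1n.
Qed.

(** The sum is [-3 + 3 * 2^n - 3^n], where 4 divides [2^n] since [n >= 2]. The base 3 is written
    [4 - 1] to expose its congruence to [-1]. *)
Lemma altpow3_mod4 (n : nat) : (1 < n)%N ->
  (4 %| altpow int 3 n + 3 + (-1) ^+ n)%Z.
Proof.
move=> n_gt1.
have pow3 m : (4 %| (4 - 1) ^+ m - (-1) ^+ m)%Z.
  elim: m => [|m IHm]; first by rewrite subrr dvdz0.
  rewrite !exprS; have -> : (4 - 1) * (4 - 1) ^+ m - -1 * (-1) ^+ m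
      = 4 * (4 - 1) ^+ m - ((4 - 1) ^+ m - (-1) ^+ m) :> int by ring.
  by rewrite rpredB // dvdz_mulr.
have -> : altpow int 3 n = - 3 + 3 * 2 ^+ n - (4 - 1) ^+ n.
  rewrite /altpow /altsum !big_ord_recl big_ord0 /= /bump /=.
  rewrite expr0n (gtn_eqF (ltnW n_gt1)) expr1n.
  have -> : (1 + (1 + (1 + 0)))%:R = 4 - 1 :> int by [].
  have -> : (1 + (1 + 0))%:R = 2 :> int by [].
  have -> : 'C(3, 1 + (1 + 0)) = 3 by [].
  rewrite !addn0 bin0 bin1 binn !mulr0 mul0rn !exprD !expr1.
  by ring.
case: n n_gt1 => [|[|n]] // _; rewrite exprS (exprS 2).
have := pow3 n.+2; set a := (4 - 1) ^+ n.+2; set b := (-1) ^+ n.+2 => dvd_ab.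
have -> : - 3 + 3 * (2 * (2 * 2 ^+ n)) - a + 3 + b
    = 4 * (3 * 2 ^+ n) - (a - b) :> int by ring.
by rewrite rpredB // dvdz_mulr.
Qed.

Lemma dvdz_altpow_prime (k n : nat) : k != 1%N -> k != 3%N -> (0 < n)%N ->
  (k.+1 %| altpow int k n + [&& prime k.+1, 2 %| n & k %| n]%N%:R)%Z.
Proof.
move=> k_neq1 k_neq3 n_gt0; case: (boolP (prime k.+1)) => /= k_prime; last first.
  rewrite addr0; case: k k_neq1 k_neq3 k_prime => [|k] // k_neq1 k_neq3 k_nprime.
  apply: dvdz_trans (dvdz_fact_altpow k.+1 n).
  exact: (@dvdn_fact_composite k.+2).
(* As [k] is not 1, the prime [k+1] is odd, and the condition [2 %| n] follows from [k %| n]. *)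
have k_even : (2 %| k)%N.
  by rewrite dvdn2; case: (even_prime k_prime) => // -[k1]; rewrite k1 in k_neq1.
rewrite (_ : (2 %| n)%N && (k %| n)%N = (k %| n)%N); last first.
  by apply: andb_idl; apply: dvdn_trans.
rewrite dvdz_Fp // rmorphD /= -altpow_intr rmorph_nat (altpow_Fp _ k_prime) //=.
by rewrite addNr.
Qed.

Lemma von_staudt_clausen (n N : nat) : (1 < n)%N -> (n < N)%N -> (3 < N)%N ->
  bernoulli n + \sum_(k < N | [&& prime k.+1, 2 %| n & k %| n]%N) (k.+1%:R)^-1
  \is a Num.int.
Proof.
move=> n_gt1 lt_nN N_gt3; have n_gt0 := ltnW n_gt1.
rewrite (bernoulli_altpow _ _ lt_nN) [X in _ + X]big_mkcond -big_split /=.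
pose b k := [&& prime k.+1, 2 %| n & k %| n]%N.
rewrite (eq_bigr (fun k : 'I_N =>
    (altpow int k n + (b k)%:R)%:~R / k.+1%:R)) => [|k _]; last first.
  rewrite -/(b k) altpow_intr rmorphD /= rmorph_nat mulrDl; congr (_ + _).
  by case: (b k); rewrite ?mul1r ?mul0r.
case: N lt_nN N_gt3 => [|[|[|[|N]]]] // _ _.
pose t k : rat := (altpow int k n + (b k)%:R)%:~R / k.+1%:R.
have t_int k : k != 1%N -> k != 3%N -> t k \is a Num.int.
  by move=> k1 k3; apply/intr_div_int/dvdz_altpow_prime.
rewrite -[X in X \is a _]/(\sum_(k < N.+4) t k) !big_ord_recl /= /bump /=.
(* Over the common denominator 4, the correction [2 [n even] - 5 - (-1)^n] equals [-4] for either
   parity of [n]. *)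
have t13 : t 1%N + t 3%N \is a Num.int.
  rewrite /t /b /= ?andbT altpow1 //.
  rewrite addr0 dvd1n andbT dvdn2.
  have -> : (-1 + (~~ odd n)%:R)%:~R / 2%:R + (altpow int 3 n)%:~R / 4%:R
      = (altpow int 3 n + 3 + (-1) ^+ n + (2 * (~~ odd n)%:R - 5 - (-1) ^+ n))%:~R
        / 4%:R :> rat.
    by rewrite !(rmorphD, rmorphB, rmorphM, rmorphN, rmorphXn) /=; field.
  apply: intr_div_int; rewrite rpredD ?altpow3_mod4 //.
  by rewrite -signr_odd; case: odd.
rewrite (_ : _ + _ = t 0%N + (t 1%N + t 3%N) + t 2%N + \sum_(i < N) t i.+4); last first.
  by rewrite /bump /=; ring.
apply: rpredD; last by apply: rpred_sum => i _; apply: t_int.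
by apply: rpredD; [apply: rpredD => //|]; apply: t_int.
Qed.

Lemma calB_Psi_int (r s : nat) : (1 < r)%N -> (1 < s)%N ->
  calB r s + \sum_(3 <= p < (r + s).+2 | prime p) ((Psi r s p)%:R / p%:R : rat)
  \is a Num.int.
Proof.
move=> r_gt1 s_gt1; set N := (r + s).+1.
have N_gt3 : (3 < N)%N by rewrite /N; lia.
have sum_int : calB r s
    + \sum_(k < N | prime k.+1) ((Psi r s k.+1)%:R / k.+1%:R : rat) \is a Num.int.
  (* Weighting von Staudt-Clausen for [s + nu] by [C(r, nu)] and exchanging the sums collects [Psi]
     at each prime; [N] exceeds every index [s + nu]. *)
  rewrite (_ : \sum_(k < N | _) _ = \sum_(nu < r.+1) 'C(r, nu)%:R *
      \sum_(k < N | [&& prime k.+1, 2 %| s + nu & k %| s + nu]%N) (k.+1%:R)^-1).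
    rewrite /calB big_mkord -big_split; apply: rpred_sum => nu _ /=.
    rewrite -mulrDr rpredM ?rpred_nat // von_staudt_clausen //; have := ltn_ord nu; lia.
  under [RHS]eq_bigr do rewrite big_mkcond mulr_sumr.
  rewrite [RHS]exchange_big [LHS]big_mkcond; apply: eq_bigr => k _ /=.
  case: ifP => _; last by rewrite big1 // => nu _; rewrite mulr0.
  rewrite /Psi big_mkcond big_mkord natr_sum mulr_suml; apply: eq_bigr => nu _.
  by case: ifP => _; rewrite /= ?mul0r ?mulr0.
have Psi2_int : (Psi r s 2)%:R / 2%:R \is a @Num.int rat by rewrite natr_div_int // Psi2_even.
(* Shifting to [p = k+1] starts the range at 1. The index 1 is not prime and the term of 2 is an
   integer, so the sum can start at 3. *)
move: sum_int; rewrite -(big_mkord (fun k => prime k.+1)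
  (fun k => (Psi r s k.+1)%:R / k.+1%:R : rat)).
rewrite -(big_add1 _ _ 0 N.+1 prime (fun p => (Psi r s p)%:R / p%:R)).
rewrite big_mkcond big_ltn // big_ltn; last by rewrite !ltnS addn_gt0 (ltnW r_gt1).
rewrite /= -big_mkcond add0r addrCA.
by move=> sum_int; rewrite -(rpredDl _ Psi2_int).
Qed.

(** * Denominators of sums of prime fractions *)

Lemma dvdn_prod_mem (l : seq nat) (p : nat) : p \in l -> (p %| \prod_(q <- l) q)%N.
Proof. by move=> p_in; rewrite (big_rem p p_in) dvdn_mulr. Qed.

Lemma coprime_prod_primes (l : seq nat) (p : nat) :
  prime p -> all prime l -> p \notin l -> coprime p (\prod_(q <- l) q)%N.
Proof.
move=> p_prime; elim: l => [|q l IHl]; first by rewrite big_nil coprimen1.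
rewrite /= inE negb_or big_cons coprimeMr => /andP[q_prime l_prime] /andP[p_neq_q p_l].
by rewrite IHl // prime_coprime // dvdn_prime2 // p_neq_q.
Qed.

Lemma dvdn_prod_primes (l : seq nat) (d : nat) : uniq l -> all prime l ->
  {in l, forall p, (p %| d)%N} -> (\prod_(p <- l) p %| d)%N.
Proof.
elim: l => [|p l IHl] /=; first by rewrite big_nil dvd1n.
move=> /andP[p_l l_uniq] /andP[p_prime l_prime] l_dvd; rewrite big_cons.
rewrite Gauss_dvd ?coprime_prod_primes // l_dvd ?mem_head // IHl // => q q_l.
by rewrite l_dvd // inE q_l orbT.
Qed.

Lemma int_mul_prime_fractions (l : seq nat) (a : nat -> nat) (x : rat) (d : nat) :
  uniq l -> all prime l ->
  x + \sum_(p <- l) (a p)%:R / p%:R \is a Num.int ->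
  d%:R * x \is a Num.int = (\prod_(p <- l | ~~ (p %| a p)) p %| d)%N.
Proof.
move=> l_uniq l_prime x_int; have prime_l p : p \in l -> prime p by move/(allP l_prime).
transitivity (d%:R * \sum_(p <- l) (a p)%:R / p%:R \is a @Num.int rat).
  have dx_int : d%:R * (x + \sum_(p <- l) (a p)%:R / p%:R) \is a Num.int.
    by rewrite rpredM ?rpred_nat.
  rewrite -[d%:R * x](addrK (d%:R * \sum_(p <- l) (a p)%:R / p%:R)) -mulrDr.
  by rewrite rpredBl.
rewrite -big_filter; set l' := filter _ l.
have l'_uniq : uniq l' by rewrite filter_uniq.
have l'_prime : all prime l'.
  by apply/allP => p; rewrite mem_filter => /andP[_ /prime_l].
apply/idP/idP => [d_int|dvd_d].
  apply: dvdn_prod_primes => // p; rewrite mem_filter => /andP[p_ndvd p_l].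
  have p_prime := prime_l p p_l.
  (* Multiplying by the product of the other primes makes every fraction but the one at [p]
     integral, so [p] divides [Q d (a p)], where [p] is coprime to [Q] and does not divide [a p]. *)
  pose Q := (\prod_(q <- rem p l) q)%N.
  have pQ : coprime p Q.
    rewrite coprime_prod_primes ?mem_rem_uniqF //.
    by apply/allP => q /mem_rem /prime_l.
  have : (Q * d * a p)%:R / p%:R \is a @Num.int rat.
    have : Q%:R * (d%:R * \sum_(p <- l) (a p)%:R / p%:R) \is a @Num.int rat.
      by rewrite rpredM ?rpred_nat.
    rewrite (big_rem p p_l) /= mulrDr mulrDr rpredDr; first by rewrite !natrM !mulrA.
    rewrite mulrCA rpredM ?rpred_nat // mulr_sumr big_seq rpred_sum // => q q_l.
    rewrite mulrA -natrM natr_div_int ?prime_gt0 ?dvdn_mulr ?dvdn_prod_mem //.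
    by rewrite prime_l // (mem_rem q_l).
  rewrite natr_div_int ?prime_gt0 // -mulnA Gauss_dvdr // Euclid_dvdM //.
  by rewrite (negPf p_ndvd) orbF.
rewrite mulr_sumr big_seq rpred_sum // => p p_l.
rewrite mulrA -natrM natr_div_int ?prime_gt0 ?prime_l //.
have [p_dvd|p_ndvd] := boolP (p %| a p)%N; first exact: dvdn_mull.
by rewrite dvdn_mulr // (dvdn_trans _ dvd_d) // dvdn_prod_mem // mem_filter p_ndvd.
Qed.

Lemma calD_eq (r s M : nat) :
  (forall d : nat, d%:R * calB r s \is a Num.int = (M %| d)%N) -> calD r s = M.
Proof.
move=> int_dvd; rewrite /calD; case: ex_minnP => d /andP[d_gt0].
rewrite int_dvd => M_dvd min_d; apply/eqP; rewrite eqn_leq (dvdn_leq d_gt0 M_dvd) andbT.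
by rewrite min_d // int_dvd dvdnn (dvdn_gt0 d_gt0 M_dvd).
Qed.

(** * Assembly of the theorem *)

Lemma finite_Psi_support (r s : nat) : (0 < s)%N ->
  [set p : nat | prime p /\ Psi r s p <> 0%N] `<=` `I_(r + s).+2.
Proof.
move=> s_gt0 p [_ Psi_neq0] /=; rewrite ltnNge; apply/negP => le_p.
by apply: Psi_neq0; rewrite Psi_large //; lia.
Qed.

Theorem theorem4p2 (r s : nat) (hr : (2 <= r)%N) (hs : (2 <= s)%N) :
  (forall p : nat, prime p ->
     ((-1) ^+ r * (Psi r s p)%:Z = (-1) ^+ s * (Psi s r p)%:Z %[mod p%:Z])%Z)
  /\ finite_set [set p : nat | prime p /\ Psi r s p <> 0%N]
  /\ calB r s
       + \sum_(p \in [set p : nat | prime p]) ((Psi r s p)%:R / p%:R : rat)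
     \is a Num.int
  /\ calB r s
       + \sum_(3 <= p < (r + s).+2 | prime p) ((Psi r s p)%:R / p%:R : rat)
     \is a Num.int
  /\ calD r s
     = \big[muln/1%N]_(p \in [set p : nat | prime p /\ ~~ (p %| Psi r s p)%N]) p
  /\ calD r s
     = (\prod_(3 <= p < (r + s).+2 | prime p && ~~ (p %| Psi r s p)) p)%N
  /\ (2 %| Psi r s 2)%N
  /\ ~~ (3 %| Psi r s 3)%N
  /\ (forall p : nat, prime p -> (5 <= p)%N ->
        (p.-1 %| r)%N || (p.-1 %| s)%N -> ~~ (p %| Psi r s p)%N).
Proof.
have r_gt0 := ltnW hr; have s_gt0 := ltnW hs.
have B_int := calB_Psi_int r s hr hs.
pose l := [seq p <- index_iota 3 (r + s).+2 | prime p].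
have l_uniq : uniq l by rewrite filter_uniq ?iota_uniq.
have l_prime : all prime l by apply: filter_all.
(* Primes outside [l] are thus harmless: each divides its value of [Psi], by evenness for 2 and by
   vanishing for large [p]. *)
have notin_l p : prime p -> p \notin l -> p = 2 \/ Psi r s p = 0%N.
  move=> p_prime; rewrite mem_filter p_prime /= mem_index_iota negb_and -!leqNgt.
  case/orP => [p_le2|p_ge]; [left|right; apply: Psi_large; lia].
  by apply/eqP; rewrite eqn_leq p_le2 prime_gt1.
have D_eq : calD r s
    = (\prod_(3 <= p < (r + s).+2 | prime p && ~~ (p %| Psi r s p)) p)%N.
  rewrite -big_filter_cond; apply: calD_eq => d.
  by apply: int_mul_prime_fractions => //; rewrite big_filter.
split=> [p p_prime|].
  apply/eqP; rewrite eqz_mod_dvd dvdz_Fp //.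
  (* The exchange of [r] and [s] was shown for odd [p]; for [p = 2] both sides are zero. *)
  have [p2|p_odd] := even_prime p_prime.
    have Psi0 r' s' : (1 < r')%N -> (Psi r' s' p)%:R = 0 :> 'F_p.
      by move=> r'_gt1; apply/eqP; rewrite -dvdn_Fp // p2 Psi2_even.
    by rewrite rmorphB !rmorphM /= -!pmulrn !Psi0 // !mulr0 subrr.
  have p_gt2 : (2 < p)%N by rewrite odd_prime_gt2.
  rewrite rmorphB !rmorphM !rmorphXn !rmorphN1 /= -!pmulrn (Psi_swap_Fp p r s) //.
  by rewrite exprD !mulrA -expr2 -exprM mulnC exprM sqrrN !expr1n mul1r subrr.
split; first by apply: (sub_finite_set (finite_Psi_support r s s_gt0)); apply: finite_II.
split.
  (* The support of the full sum contains 2, because [Psi r s 2] is a power of 2, so 2 joins the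
     list; its term is an integer and is then removed. *)
  have uniq_2l : uniq (2%N :: l) by rewrite /= l_uniq mem_filter mem_index_iota.
  rewrite (fsbigE _ _ uniq_2l).
  - rewrite (eq_bigl prime) => [|p]; last by apply/idP/idP; rewrite in_setE.
    rewrite big_cons /= big_filter_cond; under eq_bigl do rewrite andbb.
    by rewrite addrCA rpredDl // natr_div_int // Psi2_even.
  - by move=> p /=; rewrite inE => /predU1P[-> //|]; rewrite mem_filter => /andP[].
  - move=> p p_prime; rewrite inE negb_or => /andP[p_neq2 /(notin_l p p_prime)].
    by case=> [p2|->]; [rewrite p2 in p_neq2|rewrite mul0r].
split=> //; split.
  pose P p := prime p && ~~ (p %| Psi r s p)%N.
  have memP p : (p \in [set p | prime p /\ ~~ (p %| Psi r s p)%N]) = P p.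
    by apply/idP/andP; rewrite in_setE.
  rewrite D_eq (fsbigE _ _ (filter_uniq P (iota_uniq 3 ((r + s).+2 - 3)))).
  - rewrite [RHS](eq_bigl P) => [|p]; last exact: memP.
    by rewrite big_filter_cond; under [RHS]eq_bigl do rewrite andbb.
  - by move=> p; rewrite /= mem_filter => /andP[/andP[]].
  - move=> p [p_prime p_ndvd] p_notin.
    have [|p2|Psi0] := notin_l p p_prime.
    + by apply: contraNN p_notin; rewrite !mem_filter /P p_prime p_ndvd.
    + by rewrite p2 Psi2_even in p_ndvd.
    + by rewrite Psi0 dvdn0 in p_ndvd.
split=> //; split; first exact: Psi2_even.
split; first exact: Psi3_ndvd.
by move=> p p_prime p_ge5; apply: Psi_ndvd => //; apply: leq_trans p_ge5.
Qed.
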